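(* Let $\mathbb{W}=\{w\in\mathbb{R}^{n_x}\mid Vw\le \bm{1}\}$, with $V\in\mathbb{R}^{n_v\times n_x}$, be a compact convex polytope. Let $v^\star_{k-1}\in\mathbb{W}$, $\alpha^\star_{k-1}\in[0,1]$, $\hat{\mathbb{W}}^\star_{k-1}=\mathcal{W}(v^\star_{k-1},\alpha^\star_{k-1})$, and let $w_{k-1}\in\mathbb{W}$. Consider the problem $$\min_{v,\alpha}\ \alpha\quad\text{s.t.}\quad \hat{\mathbb{W}}^\star_{k-1}\subseteq\mathcal{W}(v,\alpha),\quad w_{k-1}\in\mathcal{W}(v,\alpha),\quad v\in\mathbb{W},\ \alpha\in[0,1].\tag{P}$$ Then the optimal solution of (P) can be obtained by solving the linear program $$\max_{y,\beta}\ \beta\quad\text{s.t.}\quad\begin{cases}-Vy\le(1-\beta-\alpha^\star_{k-1})\bm{1}-(1-\alpha^\star_{k-1})Vv^\star_{k-1},\\ -Vy\le(1-\beta)\bm{1}-Vw_{k-1},\\ Vy\le\beta\bm{1},\quad\beta\in[0,1].\end{cases}\tag{LP}$$ That is, if $(y^\star,\beta^\star)$ is an optimal solution of (LP), then $(v^\star,\alpha^\star)$ is an optimal solution of (P), where $\alpha^\star=1-\beta^\star$, and $v^\star=y^\star/\beta^\star$ if $\beta^\star>0$, while $v^\star$ is an arbitrary element of $\mathbb{W}$ if $\beta^\star=0$.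
   Context: All vector inequalities are componentwise, and $\bm{1}$ is the all-ones vector. For $v\in\mathbb{W}$ and $\alpha\in[0,1]$, $$\mathcal{W}(v,\alpha):=(1-\alpha)v\oplus\alpha\mathbb{W}=\{(1-\alpha)v+\alpha w\mid w\in\mathbb{W}\}.$$ Here $\hat{\mathbb{W}}^\star_{k-1}$ is the disturbance set learned at time step $k-1$ and $w_{k-1}$ is the newly observed disturbance realisation. The decision variables are $v,y\in\mathbb{R}^{n_x}$ and $\alpha,\beta\in\mathbb{R}$. *)

(* Defs.v *)
From HB Require Import structures.
From mathcomp Require Import all_boot all_order all_algebra.
From mathcomp Require Import all_classical all_reals all_analysis.

Set Implicit Arguments.
Unset Strict Implicit.
Unset Printing Implicit Defensive.

Import Order.TTheory GRing.Theory Num.Theory.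
Import numFieldNormedType.Exports.

Local Open Scope classical_set_scope.
Local Open Scope ring_scope.

Definition cvle (R : realType) (n : nat) (x y : 'cV[R]_n) : Prop :=
  forall i : 'I_n, x i 0 <= y i 0.

Definition ones (R : realType) (n : nat) : 'cV[R]_n := const_mx 1.

Definition polytope (R : realType) (nv nx : nat) (V : 'M[R]_(nv, nx)) :
    set 'cV[R]_nx :=
  [set w | cvle (V *m w) (ones R nv)].

(* W(v, alpha) = (1 - alpha) v (+) alpha W; no constraint on v or alpha here. *)
Definition shrink (R : realType) (nx : nat) (W : set 'cV[R]_nx)
    (v : 'cV[R]_nx) (alpha : R) : set 'cV[R]_nx :=
  [set (1 - alpha) *: v + alpha *: w | w in W].

Definition is_minimizer (R : realType) (T : Type) (F : set T) (f : T -> R)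
    (x : T) : Prop :=
  F x /\ forall x', F x' -> f x <= f x'.

Definition is_maximizer (R : realType) (T : Type) (F : set T) (f : T -> R)
    (x : T) : Prop :=
  F x /\ forall x', F x' -> f x' <= f x.

(* A point of (P) is the pair (v, alpha) and the objective is its second
   component; likewise for (LP) with pairs (y, beta). *)
Definition P_feasible (R : realType) (nx : nat) (W What : set 'cV[R]_nx)
    (w : 'cV[R]_nx) : set ('cV[R]_nx * R) :=
  [set p | [/\ What `<=` shrink W p.1 p.2, shrink W p.1 p.2 w,
               W p.1 & 0 <= p.2 <= 1]].

Definition P_optimal (R : realType) (nx : nat) (W What : set 'cV[R]_nx)
    (w v : 'cV[R]_nx) (alpha : R) : Prop :=
  is_minimizer (P_feasible W What w) snd (v, alpha).

Definition LP_feasible (R : realType) (nv nx : nat) (V : 'M[R]_(nv, nx))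
    (vprev : 'cV[R]_nx) (aprev : R) (w : 'cV[R]_nx) : set ('cV[R]_nx * R) :=
  [set p | let: (y, beta) := p in
    [/\ cvle (- (V *m y))
          ((1 - beta - aprev) *: ones R nv - (1 - aprev) *: (V *m vprev)),
        cvle (- (V *m y)) ((1 - beta) *: ones R nv - V *m w),
        cvle (V *m y) (beta *: ones R nv) &
        0 <= beta <= 1]].

Definition LP_optimal (R : realType) (nv nx : nat) (V : 'M[R]_(nv, nx))
    (vprev : 'cV[R]_nx) (aprev : R) (w y : 'cV[R]_nx) (beta : R) : Prop :=
  is_maximizer (LP_feasible V vprev aprev w) snd (y, beta).

(* Main.v *)
Require Import Defs.
From HB Require Import structures.
From mathcomp Require Import all_boot all_order all_algebra.
From mathcomp Require Import all_classical all_reals all_analysis.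
From mathcomp Require Import lra.

Set Implicit Arguments.
Unset Strict Implicit.
Unset Printing Implicit Defensive.

Import Order.TTheory GRing.Theory Num.Theory.
Import numFieldNormedType.Exports.

Local Open Scope classical_set_scope.
Local Open Scope ring_scope.

(** Put y = (1 - alpha) v and beta = 1 - alpha.  As W is bounded, V d <= 0
forces d = 0, so x lies in W(v, alpha) iff V x <= V y + alpha 1, even when
alpha = 0.  This settles the condition on w.  The rows of V x <= 1 need not
be tight on W, so the inclusion of the old set in W(v, alpha) yields directly
only inequalities between support functions: for c a row of V,
c ((1 - aprev) vprev - y) <= (alpha - aprev) h(c), where h(c) = max_W c.  Taking
c = +/- e_j gives aprev <= alpha, and then h(c) <= 1 yields the (LP)
constraint.  So (P) and (LP) have corresponding feasible points; a maximizer
of (LP) exists because its feasible set is a closed subset of W x [0, 1]. *)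

(** * Entries of matrix products *)

Lemma mulmx_comb (R : realType) (m n : nat) (A : 'M[R]_(m, n)) (a b : R)
    (x y : 'cV[R]_n) (i : 'I_m) :
  (A *m (a *: x + b *: y)) i 0 = a * (A *m x) i 0 + b * (A *m y) i 0.
Proof.
rewrite mulmxDr -!scalemxAr.
by move: (A *m x) (A *m y) => u v; rewrite !mxE.
Qed.

Lemma mulmxZ_entry (R : realType) (m n : nat) (A : 'M[R]_(m, n)) (a : R)
    (x : 'cV[R]_n) (i : 'I_m) :
  (A *m (a *: x)) i 0 = a * (A *m x) i 0.
Proof. by rewrite -scalemxAr mxE. Qed.

Lemma mulmx_entry_continuous (R : realType) (m n : nat) (A : 'M[R]_(m, n))
    (i : 'I_m) :
  continuous (fun x : 'cV[R]_n => (A *m x) i 0).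
Proof.
have -> : (fun x : 'cV[R]_n => (A *m x) i 0) =
    (fun x : 'cV[R]_n => \sum_j A i j * x j 0).
  by apply/funext => x; rewrite mxE.
elim: (index_enum _) => [|j s IHs] x.
  by under eq_fun do rewrite big_nil; exact: cst_continuous.
under eq_fun do rewrite big_cons.
apply: (@continuousD _ _ _ (fun x : 'cV_n => A i j * x j 0)); last exact: IHs.
apply: continuousM; first exact: cst_continuous.
exact: coord_continuous.
Qed.

(** * Geometry of the polytope and of its shrunken copies *)

Lemma polytopeP (R : realType) (nv nx : nat) (V : 'M[R]_(nv, nx))
    (x : 'cV[R]_nx) :
  polytope V x <-> forall i, (V *m x) i 0 <= 1.
Proof.
rewrite /polytope /cvle /=; move: (V *m x) => u.
by split=> h i; have := h i; rewrite mxE.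
Qed.

Lemma polytope0 (R : realType) (nv nx : nat) (V : 'M[R]_(nv, nx)) :
  polytope V 0.
Proof. by apply/polytopeP => i; rewrite mulmx0 mxE. Qed.

Lemma compact_linear_argmax (R : realType) (n : nat) (W : set 'cV[R]_n)
    (c : 'rV[R]_n) :
  compact W -> W !=set0 ->
  exists2 x, W x & forall z, W z -> (c *m z) 0 0 <= (c *m x) 0 0.
Proof.
move=> cW W0.
have [|x xW xmax] := compact_EVT_max W0 cW (f := fun z => (c *m z) 0 0).
  by apply: continuous_subspaceT; exact: mulmx_entry_continuous.
by exists x; [exact/set_mem | move=> z /mem_set; exact: xmax].
Qed.

(** If [x] maximizes the functional [d^T] over the polytope, then [x + d] is still in the polytope,
    so the squared norm of [d] is at most 0. *)
Lemma polytope_recession (R : realType) (nv nx : nat) (V : 'M[R]_(nv, nx))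
    (d : 'cV[R]_nx) :
  compact (polytope V) -> (forall i, (V *m d) i 0 <= 0) -> d = 0.
Proof.
move=> cW Vd.
have [x /polytopeP Wx xmax] :=
  compact_linear_argmax d^T cW (ex_intro _ 0 (polytope0 V)).
have /xmax : polytope V (x + d).
  apply/polytopeP => i; rewrite mulmxDr mxE.
  by have := Wx i; have := Vd i; lra.
rewrite mulmxDr mxE gerDl => dd.
have dd0 : \sum_j d j 0 ^+ 2 <= 0.
  by apply: le_trans dd; rewrite mxE; apply: ler_sum => j _; rewrite mxE.
have /psumr_eq0P dj : \sum_j d j 0 ^+ 2 = 0.
  by apply/eqP; rewrite eq_le dd0 sumr_ge0 // => j _; exact: sqr_ge0.
apply/colP => j; rewrite mxE; apply/eqP; rewrite -sqrf_eq0.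
by rewrite dj // => k _; exact: sqr_ge0.
Qed.

(** For [a > 0] the witness is found by solving for it. For [a = 0] there is nothing to divide by:
    the inequalities say that [x - v] is a recession direction, hence 0. *)
Lemma shrink_polytopeP (R : realType) (nv nx : nat) (V : 'M[R]_(nv, nx))
    (v x : 'cV[R]_nx) (a : R) :
  compact (polytope V) -> 0 <= a ->
  shrink (polytope V) v a x <->
  forall i, (V *m x) i 0 <= (1 - a) * (V *m v) i 0 + a.
Proof.
move=> cW a0; split=> [[z /polytopeP Wz <-] i|Vx].
  by rewrite mulmx_comb lerD2l ler_piMr.
have [a_eq0|a_neq0] := eqVneq a 0.
  exists 0; first exact: polytope0.
  rewrite scaler0 addr0 a_eq0 subr0 scale1r; apply/esym/eqP.
  rewrite -subr_eq0; apply/eqP; apply: (polytope_recession cW) => i.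
  rewrite mulmxBr mxE [X in _ + X]mxE.
  by have := Vx i; rewrite a_eq0; lra.
have a_gt0 : 0 < a by rewrite lt_neqAle eq_sym a_neq0.
exists (a^-1 *: (x - (1 - a) *: v)); last by rewrite scalerKV// addrC subrK.
apply/polytopeP => i; rewrite mulmxZ_entry ler_pdivrMl // mulr1.
rewrite -[x]scale1r -scaleNr mulmx_comb.
by have := Vx i; lra.
Qed.

(** * Consequences of an inclusion between shrunken copies *)

(** The value of [c] at a maximizer [x] stands for the support function. The point
    [(1 - a) *: v + a *: x] lies in the larger set, where [c] is at most its value at
    [(1 - a') *: v' + a' *: x]. *)
Lemma shrink_subset_support (R : realType) (n : nat) (W : set 'cV[R]_n)
    (v v' : 'cV[R]_n) (a a' : R) (c : 'rV[R]_n) :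
  compact W -> W !=set0 -> 0 <= a' ->
  shrink W v a `<=` shrink W v' a' ->
  exists2 x, W x & (forall z, W z -> (c *m z) 0 0 <= (c *m x) 0 0) /\
    (1 - a) * (c *m v) 0 0 - (1 - a') * (c *m v') 0 0
      <= (a' - a) * (c *m x) 0 0.
Proof.
move=> cW W0 a'0 sub; have [x Wx xmax] := compact_linear_argmax c cW W0.
exists x => //; split => //.
have /sub[z Wz] : shrink W v a ((1 - a) *: v + a *: x) by exists x.
move=> /(congr1 (fun u => (c *m u) 0 0)); rewrite !mulmx_comb.
by have := ler_wpM2l a'0 (xmax _ Wz); lra.
Qed.

Lemma polytope_absorbing (R : realType) (nv nx : nat) (V : 'M[R]_(nv, nx))
    (x : 'cV[R]_nx) :
  exists2 e : R, 0 < e & polytope V (e *: x).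
Proof.
(* [s] dominates every entry of [V *m x]; the summand 1 keeps it invertible when they all vanish. *)
pose s := 1 + \sum_i `|(V *m x) i 0|.
have s_gt0 : 0 < s by rewrite ltr_pwDl // sumr_ge0.
exists s^-1; first by rewrite invr_gt0.
apply/polytopeP => i; rewrite mulmxZ_entry ler_pdivrMl // mulr1 /s.
rewrite (bigD1 i) //=.
have : 0 <= \sum_(j | j != i) `|(V *m x) j 0| by rewrite sumr_ge0.
by have := ler_norm ((V *m x) i 0); lra.
Qed.

(** Adding the support inequalities for [c] and [- c] cancels [v] and [v'] and leaves
    [0 <= (a' - a) * width], with the width of the polytope along one axis. In dimension 0 all
    shrunken copies coincide, so an axis must exist. *)
Lemma shrink_subset_ratio (R : realType) (nv nx : nat) (V : 'M[R]_(nv, nx))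
    (v v' : 'cV[R]_nx) (a a' : R) :
  (0 < nx)%N -> compact (polytope V) -> 0 <= a' ->
  shrink (polytope V) v a `<=` shrink (polytope V) v' a' -> a <= a'.
Proof.
move=> nx_gt0 cW a'0 sub; pose j := Ordinal nx_gt0.
pose c : 'rV[R]_nx := delta_mx 0 j.
have W0 : polytope V !=set0 by exists 0; exact: polytope0.
have [e e_gt0 We] := polytope_absorbing V (delta_mx j 0 : 'cV[R]_nx).
have [x _ [xmax xle]] := shrink_subset_support c cW W0 a'0 sub.
have [z _ [zmax zle]] :=
  shrink_subset_support (- c) cW W0 a'0 sub.
(* The width is at least [e]: the polytope contains 0 and [e] times the basis vector. *)
have xe := xmax _ We; have z0 := zmax _ (polytope0 V).
rewrite mulmx0 mxE in z0.
rewrite mulmxZ_entry mul_delta_mx mxE !eqxx mulr1 in xe.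
rewrite !mulNmx in zle z0.
rewrite leNgt; apply/negP => a_lt.
have : (a' - a) * ((c *m x) 0 0 + (- (c *m z)) 0 0) < 0.
  by rewrite nmulr_rlt0; lra.
move: zle; move: (c *m z) (c *m v) (c *m v') xle => p q r.
by rewrite !mxE; lra.
Qed.

(** * Correspondence between feasible points of (P) and (LP) *)

Lemma LP_feasibleP (R : realType) (nv nx : nat) (V : 'M[R]_(nv, nx))
    (vprev : 'cV[R]_nx) (aprev : R) (w y : 'cV[R]_nx) (beta : R) :
  LP_feasible V vprev aprev w (y, beta) <->
  [/\ forall i, (1 - aprev) * (V *m vprev) i 0 + aprev
                  <= (V *m y) i 0 + (1 - beta),
      forall i, (V *m w) i 0 <= (V *m y) i 0 + (1 - beta),
      forall i, (V *m y) i 0 <= beta & 0 <= beta <= 1].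
Proof.
rewrite /LP_feasible /= /cvle.
move: (V *m vprev) (V *m w) (V *m y) => p q r.
by split=> -[h1 h2 h3 h4]; split=> // i;
  [have := h1 i|have := h2 i|have := h3 i|have := h1 i|have := h2 i
  |have := h3 i]; rewrite !mxE; lra.
Qed.

(** Writing [beta *: v] for [y] avoids division, so [beta = 0] needs no separate case. *)
Lemma LP_feasible_P_feasible (R : realType) (nv nx : nat)
    (V : 'M[R]_(nv, nx)) (vprev : 'cV[R]_nx) (aprev : R) (w v : 'cV[R]_nx)
    (beta : R) :
  compact (polytope V) -> 0 <= aprev -> polytope V v ->
  LP_feasible V vprev aprev w (beta *: v, beta) ->
  P_feasible (polytope V) (shrink (polytope V) vprev aprev) w (v, 1 - beta).
Proof.
move=> cW a0 Wv /LP_feasibleP[h1 h2 _ /andP[b0 b1]].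
have b'0 : 0 <= 1 - beta by lra.
split=> //=; last by lra.
- move=> x /shrink_polytopeP-/(_ cW a0) hx; apply/shrink_polytopeP => // i.
  by have := h1 i; have := hx i; rewrite mulmxZ_entry; lra.
- apply/shrink_polytopeP => // i.
  by have := h2 i; rewrite mulmxZ_entry; lra.
Qed.

Lemma P_feasible_LP_feasible (R : realType) (nv nx : nat)
    (V : 'M[R]_(nv, nx)) (vprev : 'cV[R]_nx) (aprev : R) (w v : 'cV[R]_nx)
    (alpha : R) :
  (0 < nx)%N -> compact (polytope V) ->
  P_feasible (polytope V) (shrink (polytope V) vprev aprev) w (v, alpha) ->
  LP_feasible V vprev aprev w ((1 - alpha) *: v, 1 - alpha).
Proof.
move=> nx_gt0 cW [/= sub ww /polytopeP Wv /andP[a0 a1]].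
have W0 : polytope V !=set0 by exists 0; exact: polytope0.
have ratio := shrink_subset_ratio nx_gt0 cW a0 sub.
apply/LP_feasibleP; split=> [i|i|i|]; last by lra.
(* Row [i] is at most 1 at its maximizer [x]; this bound may be multiplied by [alpha - aprev]
   because [ratio] makes that factor nonnegative. *)
- have [x /polytopeP/(_ i) Wx [_ le]] :=
    shrink_subset_support (row i V) cW W0 a0 sub.
  have b0 : 0 <= alpha - aprev by lra.
  have := ler_wpM2l b0 Wx; rewrite mulmxZ_entry.
  have rowE u : (row i V *m u) 0 0 = (V *m u) i 0 by rewrite -row_mul mxE.
  by move: le; rewrite !rowE; lra.
- by have /shrink_polytopeP-/(_ cW a0 i) := ww; rewrite mulmxZ_entry; lra.
- by rewrite mulmxZ_entry ler_piMr // subr_ge0.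
Qed.

(** * Existence of a maximizer of (LP) *)

Lemma LP_optimal_exists (R : realType) (nv nx : nat) (V : 'M[R]_(nv, nx))
    (vprev : 'cV[R]_nx) (aprev : R) (w : 'cV[R]_nx) :
  compact (polytope V) -> 0 <= aprev <= 1 ->
  polytope V vprev -> polytope V w ->
  exists y beta, LP_optimal V vprev aprev w y beta.
Proof.
move=> cW /andP[a0 a1] /polytopeP Wvp /polytopeP Ww.
set F := LP_feasible V vprev aprev w.
have F0 : F !=set0.
  have V0 i : (V *m (0 : 'cV[R]_nx)) i 0 = 0 by rewrite mulmx0 mxE.
  have b0 : 0 <= 1 - aprev by lra.
  (* This point corresponds to [alpha = 1], where the shrunken copy is the whole polytope. *)
  exists (0, 0); apply/LP_feasibleP.
  split=> [i|i|i|]; rewrite ?V0 ?lexx ?ler01//.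
    by have := ler_wpM2l b0 (Wvp i); lra.
  by have := Ww i; lra.
have subF : F `<=` polytope V `*` `[0, 1].
  move=> [y b] /LP_feasibleP[_ _ hy /andP[b0 b1]]; split=> /=.
    by apply/polytopeP => i; exact: le_trans (hy i) b1.
  by rewrite in_itv /= b0 b1.
have cVy i : continuous (fun p : 'cV[R]_nx * R => (V *m p.1) i 0).
  move=> p; apply: (@continuous_comp _ _ _ fst (fun x => (V *m x) i 0)).
    exact: cvg_fst.
  exact: mulmx_entry_continuous.
have csnd : continuous (@snd 'cV[R]_nx R) by move=> p; exact: cvg_snd.
have closedF : closed F.
  (* Each constraint is isolated as a closed half-space, the preimage of a closed ray under a
     continuous map. *)
  have -> : F =
    (\bigcap_i [set p | (1 - aprev) * (V *m vprev) i 0 + aprev - 1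
                          <= (V *m p.1) i 0 - p.2]) `&`
    (\bigcap_i [set p | (V *m w) i 0 - 1 <= (V *m p.1) i 0 - p.2]) `&`
    (\bigcap_i [set p | (V *m p.1) i 0 - p.2 <= 0]) `&`
    ([set p | 0 <= p.2] `&` [set p | p.2 <= 1]).
    apply/seteqP; split=> -[y b].
      move=> /LP_feasibleP[h1 h2 h3 /andP[b0 b1]].
      split; [split; [split|]|] => //= i _ /=;
        by [have := h1 i; lra | have := h2 i; lra | have := h3 i; lra].
    move=> [[[/= h1 h2] h3] [b0 b1]]; apply/LP_feasibleP.
    split=> [i|i|i|]; last by rewrite b0 b1.
    - by have := h1 i I; rewrite /=; lra.
    - by have := h2 i I; rewrite /=; lra.
    - by have := h3 i I; rewrite /=; lra.
  have cB i : continuous (fun p : 'cV[R]_nx * R => (V *m p.1) i 0 - p.2).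
    by move=> p; apply: cvgB; [exact: cVy | exact: csnd].
  have cge (f : 'cV[R]_nx * R -> R) c :
      continuous f -> closed [set p | c <= f p].
    by move/continuous_closedP => cf; exact: (cf _ (@closed_ge R c)).
  have cle (f : 'cV[R]_nx * R -> R) c :
      continuous f -> closed [set p | f p <= c].
    by move/continuous_closedP => cf; exact: (cf _ (@closed_le R c)).
  by repeat apply: closedI; try apply: closed_bigI => i _;
    [exact: cge | exact: cge | exact: cle | exact: cge | exact: cle].
have cF : compact F.
  apply: subclosed_compact closedF _ subF.
  by apply: compact_setX => //; exact: segment_compact.
have [|[y b] Fp pmax] := compact_EVT_max F0 cF (f := snd).
  exact: continuous_subspaceT.
by exists y, b; split; [exact/set_mem | move=> p /mem_set; exact: pmax].
Qed.

(** The first conjunct keeps the second from being vacuous. *)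
Theorem proposition4 (R : realType) (nv nx : nat) (nx_gt0 : (0 < nx)%N)
    (V : 'M[R]_(nv, nx)) (W : set 'cV[R]_nx) (W_def : W = polytope V)
    (W_compact : compact W)
    (vprev : 'cV[R]_nx) (vprev_in : W vprev)
    (aprev : R) (aprev_in : 0 <= aprev <= 1)
    (What : set 'cV[R]_nx) (What_def : What = shrink W vprev aprev)
    (w : 'cV[R]_nx) (w_in : W w) :
  (exists (y : 'cV[R]_nx) (beta : R), LP_optimal V vprev aprev w y beta) /\
  (forall (y : 'cV[R]_nx) (beta : R), LP_optimal V vprev aprev w y beta ->
     forall v : 'cV[R]_nx,
       (0 < beta -> v = beta^-1 *: y) ->
       (beta = 0 -> W v) ->
       P_optimal W What w v (1 - beta)).
Proof.
subst What W; split; first exact: LP_optimal_exists.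
move=> y beta [feas opt] v v_pos v_zero.
have /LP_feasibleP[_ _ Vy /andP[b0 b1]] := feas.
(* This unifies both choices of [v]: if [beta = 0], then [V *m y <= 0] forces [y = 0], so every [v]
   in the polytope fits. *)
have [y_eq Wv] : y = beta *: v /\ polytope V v.
  have [b_eq0|b_neq0] := eqVneq beta 0.
    split; last exact: v_zero.
    rewrite b_eq0 scale0r; apply: (polytope_recession W_compact) => i.
    by rewrite -b_eq0.
  have b_gt0 : 0 < beta by rewrite lt_neqAle eq_sym b_neq0.
  rewrite v_pos // scalerKV //; split=> //.
  by apply/polytopeP => i; rewrite mulmxZ_entry ler_pdivrMl // mulr1.
split.
  apply: LP_feasible_P_feasible => //; last by rewrite -y_eq.
  by case/andP: aprev_in.
(* A competitor with ratio [a'] gives an (LP) point of value [1 - a'], which is at most [beta]. *)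
move=> [v' a'] /(P_feasible_LP_feasible nx_gt0 W_compact)/opt.
by rewrite /=; lra.
Qed.
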